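(* A Banach algebra $A$ is approximately semi-contractible if and only if there are nets $(\xi_i)$ and $(\eta_i)$ (over the same directed set) in $A^{\#}\widehat{\otimes}A^{\#}$ such that $a\cdot\xi_i-\eta_i\cdot a\to 0$ for every $a\in A$, and $\pi(\xi_i)\to e$ and $\pi(\eta_i)\to e$.
   Context: $A^{\#}$ denotes the unitization of $A$ (identity $e$ adjoined), $A^{\#}\widehat{\otimes}A^{\#}$ the projective tensor product, a Banach $A^{\#}$-bimodule via $a\cdot(b\otimes c)=ab\otimes c$, $(b\otimes c)\cdot a=b\otimes ca$, and $\pi:A^{\#}\widehat{\otimes}A^{\#}\to A^{\#}$ the product map $\pi(b\otimes c)=bc$. All limits are in norm. For a Banach $A$-bimodule $X$, a derivation is a linear $D:A\to X$ with $D(ab)=a\cdot D(b)+D(a)\cdot b$; a continuous derivation $D:A\to X$ is approximately semi-inner if there are nets $(\xi_i),(\eta_i)$ in $X$ with $D(a)=\lim_i(a\cdot\xi_i-\eta_i\cdot a)$ for every $a\in A$. $A$ is approximately semi-contractible if for every Banach $A$-bimodule $X$ every continuous derivation $D:A\to X$ is approximately semi-inner. *)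

(* Defs.v *)
From HB Require Import structures.
From mathcomp Require Import all_boot all_order all_algebra.
From mathcomp Require Import all_classical all_reals all_analysis.
From mathcomp Require Export complex.
Import Order.TTheory GRing.Theory Num.Theory.
Import numFieldNormedType.Exports.

Set Implicit Arguments.
Unset Strict Implicit.
Unset Printing Implicit Defensive.

Local Open Scope ring_scope.
Local Open Scope classical_set_scope.

Section BanachDefs.
Variable K : numFieldType.

Definition directed (I : Type) (le : I -> I -> Prop) : Prop :=
  [/\ inhabited I,
      (forall i, le i i),
      (forall i j k, le i j -> le j k -> le i k) &
      (forall i j, exists k, le i k /\ le j k)].

Definition net_to (V : normedModType K) (I : Type) (le : I -> I -> Prop)
  (x : I -> V) (l : V) : Prop :=
  forall eps : K, 0 < eps -> exists i0, forall i, le i0 i -> `|x i - l| <= eps.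

Definition banach_algebra (A : completeNormedModType K) (mul : A -> A -> A)
  : Prop :=
  (forall a b c, mul a (mul b c) = mul (mul a b) c) /\
  (forall a b c, mul (a + b) c = mul a c + mul b c) /\
  (forall a b c, mul a (b + c) = mul a b + mul a c) /\
  (forall (k : K) a b, mul (k *: a) b = k *: mul a b) /\
  (forall (k : K) a b, mul a (k *: b) = k *: mul a b) /\
  (forall a b, `|mul a b| <= `|a| * `|b|).

Variable A : completeNormedModType K.
Variable mul : A -> A -> A.

Definition banach_bimodule (X : completeNormedModType K)
  (l : A -> X -> X) (r : X -> A -> X) : Prop :=
  [/\ (forall a b x, l (a + b) x = l a x + l b x)
      /\ (forall a x y, l a (x + y) = l a x + l a y)
      /\ (forall (k : K) a x, l (k *: a) x = k *: l a x)
      /\ (forall (k : K) a x, l a (k *: x) = k *: l a x),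
      (forall a b x, r x (a + b) = r x a + r x b)
      /\ (forall a x y, r (x + y) a = r x a + r y a)
      /\ (forall (k : K) a x, r x (k *: a) = k *: r x a)
      /\ (forall (k : K) a x, r (k *: x) a = k *: r x a),
      (forall a b x, l (mul a b) x = l a (l b x))
      /\ (forall a b x, r x (mul a b) = r (r x a) b),
      (forall a b x, r (l a x) b = l a (r x b)) &
      (exists C : K, 0 < C /\
         forall a x, `|l a x| <= C * `|a| * `|x| /\ `|r x a| <= C * `|a| * `|x|)].

Definition derivation (X : completeNormedModType K)
  (l : A -> X -> X) (r : X -> A -> X) (D : A -> X) : Prop :=
  [/\ (forall a b, D (a + b) = D a + D b),
      (forall (k : K) a, D (k *: a) = k *: D a) &
      (forall a b, D (mul a b) = l a (D b) + r (D a) b)].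

Definition approx_semi_inner (X : completeNormedModType K)
  (l : A -> X -> X) (r : X -> A -> X) (D : A -> X) : Prop :=
  exists (I : Type) (le : I -> I -> Prop), directed le /\
    exists xi eta : I -> X,
      forall a, net_to le (fun i => l a (xi i) - r (eta i) a) (D a).

Definition approx_semi_contractible : Prop :=
  forall (X : completeNormedModType K) (l : A -> X -> X) (r : X -> A -> X),
    banach_bimodule l r ->
    forall D : A -> X, derivation l r D -> continuous D ->
    approx_semi_inner l r D.

(* element (a, alpha) stands for a + alpha e; norm ||a|| + |alpha| *)
Definition unit_mul (x y : A * K) : A * K :=
  (mul x.1 y.1 + y.2 *: x.1 + x.2 *: y.1, x.2 * y.2).
Definition unit_norm (x : A * K) : K := `|x.1| + `|x.2|.
Definition unit_e : A * K := (0, 1).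
Definition unit_sub (x y : A * K) : A * K := (x.1 - y.1, x.2 - y.2).
Definition unit_emb (a : A) : A * K := (a, 0).

(* An element of A# (^) A# is represented as  sum_n x_n (x) y_n  with
   sum_n ||x_n|| ||y_n|| < oo. *)
Definition tensor_rep := nat -> (A * K) * (A * K).

Definition abs_summable (u : tensor_rep) : Prop :=
  cvgn (series (fun n => unit_norm (u n).1 * unit_norm (u n).2)).

(* bounded bilinear forms on A# x A# of norm <= 1; these form the unit ball
   of the dual space (A# (^) A#)^* *)
Definition bil_form_unit_ball (phi : A * K -> A * K -> K) : Prop :=
  [/\ (forall x x' y, phi (unit_sub x x') y = phi x y - phi x' y),
      (forall x y y', phi x (unit_sub y y') = phi x y - phi x y'),
      (forall (k : K) x y, phi (k *: x.1, k * x.2) y = k * phi x y),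
      (forall (k : K) x y, phi x (k *: y.1, k * y.2) = k * phi x y) &
      (forall x y, `|phi x y| <= unit_norm x * unit_norm y)].

Definition tensor_eval (phi : A * K -> A * K -> K) (u : tensor_rep) : K :=
  limn (series (fun n => phi (u n).1 (u n).2)).

(* computed componentwise in A (+) K (same as the limit in the product) *)
Definition tensor_pi (u : tensor_rep) : A * K :=
  (limn (series (fun n => (unit_mul (u n).1 (u n).2).1)),
   limn (series (fun n => (unit_mul (u n).1 (u n).2).2))).

Definition tensor_lact (a : A) (u : tensor_rep) : tensor_rep :=
  fun n => (unit_mul (unit_emb a) (u n).1, (u n).2).
Definition tensor_ract (u : tensor_rep) (a : A) : tensor_rep :=
  fun n => ((u n).1, unit_mul (u n).2 (unit_emb a)).

(* || u - v ||_pi -> 0 along a net, via the duality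
   ||w||_pi = sup { |<phi, w>| : phi bounded bilinear, ||phi|| <= 1 } *)
Definition tensor_net_diff_to0 (I : Type) (le : I -> I -> Prop)
  (u v : I -> tensor_rep) : Prop :=
  forall eps : K, 0 < eps -> exists i0, forall i, le i0 i ->
    forall phi, bil_form_unit_ball phi ->
      `|tensor_eval phi (u i) - tensor_eval phi (v i)| <= eps.

Definition pi_net_to_e (I : Type) (le : I -> I -> Prop) (u : I -> tensor_rep)
  : Prop :=
  forall eps : K, 0 < eps -> exists i0, forall i, le i0 i ->
    unit_norm (unit_sub (tensor_pi (u i)) unit_e) <= eps.

End BanachDefs.

(* Main.v *)
Require Import Defs.
From HB Require Import structures.
From mathcomp Require Import all_boot all_order all_algebra.
From mathcomp Require Import all_classical all_reals all_analysis.
From mathcomp Require Import complex ring lra.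
Import Order.TTheory GRing.Theory Num.Theory.
Import numFieldNormedType.Exports.

Set Implicit Arguments.
Unset Strict Implicit.
Unset Printing Implicit Defensive.

Local Open Scope ring_scope.
Local Open Scope classical_set_scope.

                                                                             
                                                    
                                                                      
                                                                                 
                                                                              
                        

                                                                                
                                                                             
                                                                                 
                                                                                
                                                                           
                                                                               
                                                                  

                                    

(** Both directions turn on the kernel of pi in A# (x)^ A# and the derivation a -> a (x) e - e (x) a
    into it.

    From nets to derivations: let D : A -> X be a continuous derivation, extended to A# by D(e) = 0.
    The bounded bilinear map (x, y) -> x.D(y) induces a bounded linear map Psi on the projective
    tensor product, with Psi(a.u) = a.Psi(u) and, by the Leibniz rule, Psi(u.a) = pi(u).D(a) +
    Psi(u).a. Hence a.Psi(xi_i) - Psi(eta_i).a = Psi(a.xi_i - eta_i.a) + pi(eta_i).D(a), which tends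
    to D(a). Convergence of tensors is tested on scalar bilinear forms of norm at most 1, so the
    norm of Psi(v) - Psi(w) in X is recovered from a norming functional, which Hahn-Banach supplies
    ([norming_functional], [Psi_tensor_bound], [approx_diagonal_semi_inner]).

    From semi-contractibility to nets: apply the hypothesis to ker pi and to a -> a (x) e - e (x) a.
    If this is the limit of a.xi'_i - eta'_i.a with xi'_i, eta'_i in ker pi, then e (x) e - xi'_i
    and e (x) e - eta'_i are the required nets. The Banach space ker pi is realized inside the
    functions on bounded bilinear forms, with the dual norm: it consists of the functionals
    approximable by finite tensors whose product is small ([kernel_functional], [kernel_bimodule]).
    Replacing each element by a finite approximant costs an error, so the nets are indexed by the
    given directed set times the tolerances ([semi_contractible_approx_diagonal]). *)

(** * The Hahn-Banach theorem and norming functionals *)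

Section HahnBanach.
Variables (R : realType) (V : lmodType R[i]) (p : V -> R).
Hypothesis p_subadd : forall x y, p (x + y) <= p x + p y.
Hypothesis p_hom : forall (t : R) x, 0 <= t -> p (t%:C%C *: x) = t * p x.

(** Partial real-linear functionals are encoded by their graphs in V x R. Single-valuedness is not
    part of the encoding; it follows from domination by [p]. *)
Definition real_subspace (G : set (V * R)) :=
  forall (t : R) x y, G x -> G y -> G (t%:C%C *: x.1 + y.1, t * x.2 + y.2).

Definition dominated (G : set (V * R)) := forall x, G x -> x.2 <= p x.1.

Definition graph_extension (G : set (V * R)) (y : V) (c : R) : set (V * R) :=
  [set z | exists x t, G x /\ z = (x.1 + t%:C%C *: y, x.2 + t * c)].

Lemma real_subspace0 G : real_subspace G -> G !=set0 -> G (0, 0).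
Proof.
move=> linG [x Gx]; have := linG (-1) _ _ Gx Gx.
by rewrite rmorphN1 scaleN1r addNr mulN1r addNr.
Qed.

Lemma real_subspaceZ G t x : real_subspace G -> G x ->
  G (t%:C%C *: x.1, t * x.2).
Proof.
move=> linG Gx; have := linG t _ _ Gx (real_subspace0 linG (ex_intro _ _ Gx)).
by rewrite /= !addr0.
Qed.

Lemma graph_extension_linear G y c :
  real_subspace G -> real_subspace (graph_extension G y c).
Proof.
move=> linG t _ _ [x [a [Gx ->]]] [z [b [Gz ->]]] /=.
exists (t%:C%C *: x.1 + z.1, t * x.2 + z.2), (t * a + b); split.
  exact: linG.
congr pair => /=; last by ring.
by rewrite scalerDr rmorphD rmorphM scalerDl scalerA addrACA.
Qed.

(** The value [c] at [y] has to lie above every x.2 - p(x.1 - y) and below every p(z.1 + y) - z.2.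
    Subadditivity puts each of the former below each of the latter, so the supremum of the former
    works; a coefficient t <> 0 is scaled to 1 or -1 by homogeneity. *)
Lemma dominated_extension G y : real_subspace G -> dominated G -> G !=set0 ->
  exists c, dominated (graph_extension G y c).
Proof.
move=> linG domG G0.
pose S := [set x.2 - p (x.1 - y) | x in G].
have ubS z : G z -> ubound S (p (z.1 + y) - z.2).
  move=> Gz _ [x Gx <-].
  have := domG _ (linG 1 _ _ Gx Gz); rewrite /= rmorph1 scale1r mul1r.
  have -> : x.1 + z.1 = (x.1 - y) + (z.1 + y) by rewrite addrACA addNr addr0.
  have := p_subadd (x.1 - y) (z.1 + y); lra.
have supS : has_sup S.
  case: G0 => x Gx; split; first by exists (x.2 - p (x.1 - y)); exists x.
  by exists (p (x.1 + y) - x.2); exact: ubS.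
exists (sup S) => _ [x [t [Gx ->]]] /=.
have le1 z : G z -> z.2 - sup S <= p (z.1 - y).
  move=> Gz; have : z.2 - p (z.1 - y) <= sup S.
    by apply: sup_upper_bound => //; exists z.
  lra.
have le2 z : G z -> z.2 + sup S <= p (z.1 + y).
  move=> Gz; have : sup S <= p (z.1 + y) - z.2.
    by apply: ge_sup; [exact: supS.1|exact: ubS].
  lra.
have [t0|t0|->] := ltgtP t 0; last first.
- by rewrite rmorph0 scale0r mul0r !addr0; exact: domG.
- have tn0 : t != 0 by rewrite gt_eqF.
  have := le2 _ (real_subspaceZ t^-1 linG Gx) => /=.
  rewrite -(ler_pM2l t0) -(p_hom _ (ltW t0)) scalerDr scalerA -rmorphM.
  by rewrite divff // rmorph1 scale1r mulrDr mulrA divff // mul1r.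
- have s0 : 0 < - t by rewrite oppr_gt0.
  have sn0 : - t != 0 by rewrite gt_eqF.
  have := le1 _ (real_subspaceZ (- t)^-1 linG Gx) => /=.
  rewrite -(ler_pM2l s0) -(p_hom _ (ltW s0)) scalerDr scalerA -rmorphM.
  rewrite divff // rmorph1 scale1r mulrDr mulrA divff // mul1r.
  by rewrite scalerN -scaleNr -rmorphN mulrNN opprK.
Qed.

Lemma hahn_banach_real (x0 : V) (r0 : R) :
  (forall t, t * r0 <= p (t%:C%C *: x0)) ->
  exists g : V -> R,
    [/\ (forall (t : R) x y, g (t%:C%C *: x + y) = t * g x + g y),
        (forall x, g x <= p x) & g x0 = r0].
Proof.
move=> dom0.
pose G0 : set (V * R) := [set z | exists t, z = (t%:C%C *: x0, t * r0)].
have G0x0 : G0 (x0, r0) by exists 1; rewrite rmorph1 scale1r mul1r.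
have linG0 : real_subspace G0.
  move=> t _ _ [a ->] [b ->] /=; exists (t * a + b).
  by rewrite scalerA -rmorphM -scalerDl -rmorphD mulrDl mulrA.
(* The point is demanded of nonempty graphs only, so that the union of the empty chain satisfies
   [P]. A maximal graph is nonempty all the same, since [G0] strictly contains the empty set. *)
pose P G := [/\ real_subspace G, dominated G & G !=set0 -> G (x0, r0)].
have [|G [[linG domG GG0] maxG]] := @Zorn_bigcup _ P.
  move=> F FP totF; split.
  - move=> t x y [X FX Xx] [Y FY Yy].
    have [XY|YX] := totF _ _ FX FY.
    + by exists Y => //; have [+ _ _] := FP _ FY; apply => //; exact: XY.
    + by exists X => //; have [+ _ _] := FP _ FX; apply => //; exact: YX.
  - by move=> x [X FX Xx]; have [_ + _] := FP _ FX; exact.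
  - move=> [x [X FX Xx]]; exists X => //.
    by have [_ _] := FP _ FX; apply; exists x.
have Gn0 : G !=set0.
  apply/set0P/eqP => GE; apply: (maxG G0).
    by rewrite GE properEneq; split => //; apply/eqP => /seteqP[_ /(_ _ G0x0)].
  by split => // _ [t ->]; exact: dom0.
have Gx0 := GG0 Gn0.
have total y : exists r, G (y, r).
  apply: contrapT => /forallNP Gy.
  have [c domc] := dominated_extension y linG domG Gn0.
  have subG x : G x -> graph_extension G y c x.
    by move=> Gx; exists x, 0; split => //; rewrite rmorph0 scale0r mul0r !addr0;
      case: x {Gx}.
  apply: (maxG (graph_extension G y c)).
    rewrite properEneq; split => //; apply/eqP => GE.
    apply: (Gy c); rewrite GE; exists (0, 0), 1; split.
      exact: real_subspace0.
    by rewrite rmorph1 scale1r mul1r !add0r.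
  by split => //; [exact: graph_extension_linear|move=> _; exact: subG].
(* Two values over [x] put both (0, r - s) and (0, s - r) in [G], and domination by p 0 = 0 makes
   both differences nonpositive. *)
have fun_G x r s : G (x, r) -> G (x, s) -> r = s.
  have p0 : p 0 = 0.
    by rewrite -(scale0r 0) -[0 in LHS](rmorph0 (real_complex R)) p_hom // mul0r.
  move=> Gr Gs; apply/eqP; rewrite eq_le.
  have := domG _ (linG (-1) _ _ Gr Gs); have := domG _ (linG (-1) _ _ Gs Gr).
  rewrite /= !rmorphN1 !scaleN1r !addNr p0 !mulN1r !(addrC (- _)) !subr_le0.
  by move=> -> ->.
have [g gG] := choice total.
exists g; split.
- by move=> t x y; apply: (fun_G _ _ _ (gG _)); exact: (linG t _ _ (gG x) (gG y)).
- by move=> x; exact: (domG _ (gG x)).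
- exact: fun_G (gG x0) Gx0.
Qed.

End HahnBanach.

Section Norming.
Variables (R : realType) (V : normedModType R[i]).

Lemma Re_norm (x : V) : ((@complex.Re R `|x|)%:C)%C = `|x|.
Proof.
have := normr_ge0 x; rewrite lecE => /andP[/eqP im _].
by case: `|x| im => a b /= ->.
Qed.

(** Complexification: a real functional [g] dominated by the norm with g(x0) = |x0| is the real part
    of the complex-linear f(x) = g(x) - i g(i x). *)
Lemma norming_functional (x0 : V) :
  exists f : V -> R[i],
    [/\ (forall k x y, f (k *: x + y) = k * f x + f y),
        (forall x, `|f x| <= `|x|) & `|x0| <= `|f x0|].
Proof.
pose p (x : V) := @complex.Re R `|x|.
have p_subadd x y : p (x + y) <= p x + p y.
  by rewrite -lecR rmorphD /= !Re_norm ler_normD.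
have p_hom (t : R) x : 0 <= t -> p (t%:C%C *: x) = t * p x.
  move=> t0; apply: (@complexI R); rewrite rmorphM /= !Re_norm normrZ.
  by rewrite ger0_norm // ler0c.
have p_ge0 x : 0 <= p x by rewrite -ler0c Re_norm.
have [|g [linG domG gx0]] := hahn_banach_real p_subadd p_hom (x0 := x0) (r0 := p x0).
  move=> t; have [t0|t0] := leP 0 t; first by rewrite p_hom.
  by rewrite (le_trans _ (p_ge0 _)) // mulr_le0_ge0 // ltW.
have gD x y : g (x + y) = g x + g y.
  by have := linG 1 x y; rewrite rmorph1 scale1r mul1r.
have gZ (t : R) x : g (t%:C%C *: x) = t * g x.
  have g0 : g 0 = 0 by apply: (@addIr _ (g 0)); rewrite -gD !add0r.
  by have := linG t x 0; rewrite g0 !addr0.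
have gN x : g (- x) = - g x by have := gZ (-1) x; rewrite rmorphN1 scaleN1r mulN1r.
pose f x : R[i] := (g x -i* g ('i%C *: x))%C.
have fD x y : f (x + y) = f x + f y.
  by rewrite /f scalerDr !gD opprD.
have fZ k x : f (k *: x) = k * f x.
  case: k => a b; have E (y : V) :
      ((a +i* b)%C *: y) = a%:C%C *: y + b%:C%C *: ('i%C *: y).
    rewrite scalerA -scalerDl; congr (_ *: _); apply/eqP.
    by rewrite eq_complex /=; apply/andP; split; apply/eqP; ring.
  rewrite /f scalerA mulrC -scalerA !E !gD !gZ scalerA -expr2 sqr_i scaleN1r gN.
  apply/eqP; rewrite eq_complex /=; apply/andP; split; apply/eqP; ring.
exists f; split.
- by move=> k x y; rewrite fD fZ.
- move=> x; have [->|fx0] := eqVneq (f x) 0; first by rewrite normr0.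
                                                               
  (* Rotating [x] by the unimodular [c] makes the value of [f] real, hence equal to that of [g],
     which the norm dominates. *)
  pose c := `|f x| / f x.
  have cn : `|c| = 1 by rewrite normrM normr_id normfV divff // normr_eq0.
  have fc : f (c *: x) = `|f x| by rewrite fZ /c divfK.
  rewrite -fc -[`|x|]mul1r -cn -normrZ -Re_norm.
  have -> : f (c *: x) = (g (c *: x))%:C%C.
    have := normr_ge0 (f x); rewrite -fc lecE => /andP[im _].
    by apply/eqP; rewrite eq_complex eqxx; exact: im.
  by rewrite lecR.
- rewrite -Re_norm.
  have <- : complex.Re (f x0) = @complex.Re R `|x0| by rewrite /= gx0.
  by apply: le_trans (normc_ge_Re (f x0)); rewrite lecR ler_norm.
Qed.

End Norming.

                                            

(** * The scalar field R[i]: completeness and suprema *)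

Definition complete_field (K : numFieldType) :=
  forall F : set_system K, ProperFilter F -> cauchy F -> cvg F.

(** Norms take values in the scalar field, whose order is only partial. Suprema of bounded
    nonnegative sets suffice to define the norm [fs_norm]. *)
Definition nonneg_lub_property (K : numFieldType) :=
  forall S : set K, S !=set0 -> (forall x, S x -> 0 <= x) ->
  (exists c, forall x, S x -> x <= c) ->
  exists s, (forall x, S x -> x <= s) /\
            forall c, (forall x, S x -> x <= c) -> s <= c.

Lemma norm_real_complex (R : realType) (x : R) : `|x%:C%C| = `|x|%:C%C.
Proof. by rewrite normc_def /= expr0n addr0 sqrtr_sqr. Qed.

Lemma norm_imaginary_unit (R : realType) : `|'i%C : R[i]| = 1.
Proof. by rewrite normc_def /= expr0n add0r expr1n sqrtr1. Qed.

Lemma normc_ge_Im (R : realType) (z : R[i]) : `|complex.Im z|%:C%C <= `|z|.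
Proof.
have := normc_ge_Re (z * 'i%C).
by rewrite ReiNIm normrN normrM norm_imaginary_unit mulr1.
Qed.

Lemma normc_le_ReIm (R : realType) (z : R[i]) :
  `|z| <= (`|complex.Re z| + `|complex.Im z|)%:C%C.
Proof.
rewrite {1}(complexE z) (le_trans (ler_normD _ _)) // normrM.
by rewrite norm_imaginary_unit mul1r !norm_real_complex rmorphD.
Qed.

Lemma complex_complete (R : realType) : complete_field R[i].
Proof.
move=> F FF /cauchyP Fc.
have cauchy_part (f : R[i] -> R) : (forall z w, `|f z - f w|%:C%C <= `|z - w|) ->
    exists l : R, f z @[z --> F] --> l.
  move=> f1; apply/cvg_ex/cauchy_cvgP/cauchyP => e e0.
  have [|x Fx] := Fc e%:C%C; first by rewrite ltcR.
  exists (f x); suff : F (f @^-1` ball (f x) e) by [].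
  move: Fx; apply: filterS => z /=; rewrite -!ball_normE /= => xz.
  by rewrite -ltcR; apply: le_lt_trans xz.
have [|a Fa] := cauchy_part (@complex.Re R).
  by case=> z1 z2 [w1 w2]; exact: (normc_ge_Re ((z1 +i* z2) - (w1 +i* w2))%C).
have [|b Fb] := cauchy_part (@complex.Im R).
  by case=> z1 z2 [w1 w2]; exact: (normc_ge_Im ((z1 +i* z2) - (w1 +i* w2))%C).
apply/cvg_ex; exists (a +i* b)%C.
apply/cvgrPdist_le => e e0.
have eR : ((complex.Re e)%:C%C = e) by rewrite RRe_real // gtr0_real.
have e2 : 0 < complex.Re e / 2 by rewrite divr_gt0 // -ltcR eR.
move/cvgrPdist_le : Fa => /(_ _ e2) Fa.
move/cvgrPdist_le : Fb => /(_ _ e2) Fb.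
near=> z.
rewrite -eR (le_trans (normc_le_ReIm _)) // lecR [leRHS]splitr.
have az : `|a - complex.Re z| <= complex.Re e / 2 by near: z.
have bz : `|b - complex.Im z| <= complex.Re e / 2 by near: z.
have ReB (x y : R[i]) : complex.Re (x - y) = complex.Re x - complex.Re y.
  by case: x y => ? ? [].
have ImB (x y : R[i]) : complex.Im (x - y) = complex.Im x - complex.Im y.
  by case: x y => ? ? [].
by rewrite ReB ImB lerD.
Unshelve. all: by end_near. Qed.

Lemma complex_nonneg_lub (R : realType) : nonneg_lub_property R[i].
Proof.
move=> S [x0 Sx0] S0 [c Sc].
have real_S x : S x -> (complex.Re x)%:C%C = x.
  move=> /S0; case: x => a b; rewrite lecE /= => /andP[/eqP -> _] //.
pose T := [set complex.Re x | x in S].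
have supT : has_sup T.
  split; first by exists (complex.Re x0); exists x0.
  by exists (complex.Re c) => _ [x /Sc + <-]; rewrite lecE => /andP[].
exists (sup T)%:C%C; split.
  move=> x Sx; rewrite -(real_S _ Sx) lecR; apply: sup_upper_bound => //.
  by exists x.
move=> d Sd.
(* Comparable complex numbers have equal imaginary parts, so an upper bound of a set containing a
   real number is real. *)
have -> : d = (complex.Re d)%:C%C.
  have := Sd _ Sx0; rewrite -(real_S _ Sx0) lecE /= => /andP[/eqP + _].
  by case: d {Sd} => ? ? /= ->.
rewrite lecR; apply: ge_sup; first exact: supT.1.
by move=> _ [x /Sd + <-]; rewrite lecE => /andP[].
Qed.

                                                     

                                                                               
                                                                             
                 
(** * Banach spaces of functions under a weighted supremum norm *)

(** The intended norm of f is the least c >= 0 with |f t| <= c * M whenever [fs_weight t M]. The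
    weight is a relation: for a bilinear form, M runs over all its positive bounds, which avoids
    singling out the norm of the form. Closedness under approximation in this norm is what yields
    completeness. *)
Record function_space (K : numFieldType) := FunctionSpace {
  fs_dom : Type;
  fs_weight : fs_dom -> K -> Prop;
  fs_mem : set (fs_dom -> K^o);
  fs_complete : complete_field K;
  fs_lub : nonneg_lub_property K;
  fs_weight_gt0 : forall t M, fs_weight t M -> 0 < M;
  fs_weight_ex : forall t, exists M, fs_weight t M;
  fs_submod : fs_mem 0 /\
    forall k f g, fs_mem f -> fs_mem g -> fs_mem (k *: f + g);
  fs_bounded : forall f, fs_mem f ->
    exists c, forall t M, fs_weight t M -> `|f t| <= c * M;
  fs_closed : forall f,
    (forall e, 0 < e -> exists2 g, fs_mem g &
       forall t M, fs_weight t M -> `|f t - g t| <= e * M) -> fs_mem f }.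

Section FunctionSpaceBanach.
Variables (K : numFieldType) (S : function_space K).

Definition fs_pred : {pred (fs_dom S -> K^o)} :=
  [pred f | `[< fs_mem (f : fs_dom S -> K^o) >]].

Lemma fs_submod_closed : submod_closed fs_pred.
Proof.
have [S0 SP] := fs_submod S; split; first exact/asboolP.
by move=> k f g /asboolP Sf /asboolP Sg; apply/asboolP; exact: SP.
Qed.

HB.instance Definition _ :=
  GRing.isSubmodClosed.Build K (fs_dom S -> K^o) fs_pred fs_submod_closed.

Record fs_type := FsElt { fs_fun : fs_dom S -> K^o; _ : fs_fun \in fs_pred }.

HB.instance Definition _ := [isSub for fs_fun].
HB.instance Definition _ := [Choice of fs_type by <:].
HB.instance Definition _ := [SubChoice_isSubLmodule of fs_type by <:].

Lemma fs_funP (x : fs_type) : fs_mem (fs_fun x).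
Proof. by case: x => f Sf; exact: (asboolW Sf). Qed.

Lemma fs_fun_surj f : fs_mem f -> exists x : fs_type, fs_fun x = f.
Proof. by move=> Sf; have Sf' := asboolT Sf; exists (@FsElt f Sf'). Qed.

Lemma fs_funD (x y : fs_type) t : fs_fun (x + y) t = fs_fun x t + fs_fun y t.
Proof. by []. Qed.

Lemma fs_funZ k (x : fs_type) t : fs_fun (k *: x) t = k * fs_fun x t.
Proof. by []. Qed.

Lemma fs_funB (x y : fs_type) t : fs_fun (x - y) t = fs_fun x t - fs_fun y t.
Proof. by []. Qed.

                                                                            
(** The value 0 is added so that the set is nonempty even over an empty domain. *)
Definition fs_values (x : fs_type) : set K :=
  [set v | v = 0 \/ exists t M, fs_weight t M /\ v = `|fs_fun x t| / M].

Definition fs_norm (x : fs_type) : K :=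
  xget 0 [set s | (forall v, fs_values x v -> v <= s) /\
                  forall c, (forall v, fs_values x v -> v <= c) -> s <= c].

(** [fs_bounded] makes the supremum exist, so [xget] returns it and not its default. The norm axioms
    are all derived from this characterization. *)
Lemma fs_norm_leP (x : fs_type) c :
  (fs_norm x <= c) <->
  (0 <= c /\ forall t M, fs_weight t M -> `|fs_fun x t| <= c * M).
Proof.
have bP d : (forall v, fs_values x v -> v <= d) <->
    (0 <= d /\ forall t M, fs_weight t M -> `|fs_fun x t| <= d * M).
  split=> [xd|[d0 xd] v [->//|[t [M [tM ->]]]]].
    split=> [|t M tM]; first by apply: xd; left.
    rewrite -ler_pdivrMr ?(fs_weight_gt0 tM) //.
    by apply: xd; right; exists t, M.
  by rewrite ler_pdivrMr ?(fs_weight_gt0 tM) //; exact: xd.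
rewrite -bP.
have [s sP] : exists s, [set s | (forall v, fs_values x v -> v <= s) /\
    forall c, (forall v, fs_values x v -> v <= c) -> s <= c] s.
  apply: (fs_lub S).
  - by exists 0; left.
  - move=> _ [->//|[t [M [tM ->]]]].
    by rewrite divr_ge0 // ltW // (fs_weight_gt0 tM).
  - have [d xd] := fs_bounded (fs_funP x).
    (* The constant [d] carries no sign: a single weight forces d >= 0, and without weights the
       bound 0 serves. *)
    have [[t [M tM]]|noweight] := pselect (exists t M, @fs_weight K S t M).
      exists d; apply/bP; split => //.
      have := le_trans (normr_ge0 _) (xd _ _ tM).
      by rewrite pmulr_lge0 ?(fs_weight_gt0 tM).
    exists 0; apply/bP; split => // t M tM.
    by case: noweight; exists t, M.
have [sub lub] := xgetPex 0 (ex_intro _ _ sP).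
by split=> [xc v /sub/le_trans|/lub//]; exact.
Qed.

Lemma fs_norm_ge0 x : 0 <= fs_norm x.
Proof. by have /fs_norm_leP[] := lexx (fs_norm x). Qed.

Lemma fs_fun_le x t M : fs_weight t M -> `|fs_fun x t| <= fs_norm x * M.
Proof. by have /fs_norm_leP[_] := lexx (fs_norm x); exact. Qed.

Lemma fs_ler_normD x y : fs_norm (x + y) <= fs_norm x + fs_norm y.
Proof.
apply/fs_norm_leP; split; first by rewrite addr_ge0 ?fs_norm_ge0.
move=> t M tM; rewrite fs_funD mulrDl (le_trans (ler_normD _ _)) //.
by apply: lerD; exact: fs_fun_le.
Qed.

Lemma fs_normZ k x : fs_norm (k *: x) = `|k| * fs_norm x.
Proof.
have le_kx : fs_norm (k *: x) <= `|k| * fs_norm x.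
  apply/fs_norm_leP; split; first by rewrite mulr_ge0 ?fs_norm_ge0.
  by move=> t M tM; rewrite fs_funZ normrM -mulrA ler_wpM2l ?fs_fun_le.
have [k0|k0] := eqVneq k 0.
  by apply/eqP; rewrite k0 normr0 mul0r eq_le fs_norm_ge0 andbT -k0
    (le_trans le_kx) // k0 normr0 mul0r.
apply/eqP; rewrite eq_le le_kx /= mulrC -ler_pdivlMr ?normr_gt0 //.
apply/fs_norm_leP; split; first by rewrite divr_ge0 ?fs_norm_ge0.
move=> t M tM; rewrite mulrAC ler_pdivlMr ?normr_gt0 // mulrC -normrM -fs_funZ.
exact: fs_fun_le.
Qed.

Lemma fs_norm0_eq0 x : fs_norm x = 0 -> x = 0.
Proof.
move=> x0; apply: val_inj; apply/funext => t /=.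
have [M tM] := fs_weight_ex t.
by apply/eqP; rewrite -normr_le0 (le_trans (fs_fun_le x tM)) // x0 mul0r.
Qed.

HB.instance Definition _ :=
  Lmodule_isNormed.Build K fs_type fs_ler_normD fs_normZ fs_norm0_eq0.

Lemma fs_normP (x : fs_type) c :
  (`|x| <= c) <->
  (0 <= c /\ forall t M, fs_weight t M -> `|fs_fun x t| <= c * M).
Proof. exact: fs_norm_leP. Qed.

(** A Cauchy filter has a pointwise limit [h]; the Cauchy condition makes the approximation of [h]
    uniform relative to the weights, so [fs_closed] places [h] in the space and the filter converges
    to it in norm. *)
Lemma fs_type_complete (F : set_system fs_type) :
  ProperFilter F -> cauchy F -> cvg F.
Proof.
move=> FF /cauchyP Fc.
have distF t M (x y : fs_type) : fs_weight t M ->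
    `|fs_fun x t - fs_fun y t| <= `|x - y| * M.
  by move=> tM; rewrite -fs_funB; exact: fs_fun_le.
have lim_ex t : exists l : K, fs_fun x t @[x --> F] --> l.
  apply/cvg_ex; apply: (fs_complete S); apply/cauchyP => e e0.
  have [M tM] := fs_weight_ex t; have M0 := fs_weight_gt0 tM.
  have [|x Fx] := Fc (e / M); first by rewrite divr_gt0.
  exists (fs_fun x t).
  suff : F (fun y : fs_type => ball (fs_fun x t : K) e (fs_fun y t)) by [].
  move: Fx; apply: filterS => y; rewrite -!ball_normE /= => xy.
  by rewrite (le_lt_trans (distF _ _ _ _ tM)) // -ltr_pdivlMr.
have [h hP] := choice lim_ex.
have near_h e : 0 < e -> exists2 x : fs_type, (\forall y \near F, `|x - y| <= e) &
    forall t M, fs_weight t M -> `|fs_fun x t - h t| <= e * M.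
  move=> e0; have [x Fx] := Fc e e0.
  have Fx' : \forall y \near F, `|x - y| <= e.
    by move: Fx; apply: filterS => y; rewrite -ball_normE /= => /ltW.
  exists x => // t M tM.
  apply/ler_addgt0Pr => d d0.
  have /cvgrPdist_le /(_ d d0) Fh := hP t.
  (* This [y] is near [x] in norm and near [h] at the single point [t]; it may depend on [t],
     because it disappears from the final estimate. *)
  have [y [xy yh]] := filter_ex (filterI Fx' Fh).
  rewrite -(subrKA (fs_fun y t)) (le_trans (ler_normD _ _)) //.
  rewrite lerD //; last by rewrite distrC.
  rewrite (le_trans (distF _ _ _ _ tM)) // ler_wpM2r // ltW //.
  exact: fs_weight_gt0 tM.
have [z zh] : exists z : fs_type, fs_fun z = h.
  apply: fs_fun_surj; apply: fs_closed => e e0.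
  have [x _ xh] := near_h e e0; exists (fs_fun x); first exact: fs_funP.
  by move=> t M tM; rewrite distrC; exact: xh.
apply/cvg_ex; exists z; apply/cvgrPdist_le => e e0.
have e20 : 0 < e / 2 by rewrite divr_gt0.
have [x Fx xh] := near_h _ e20.
near=> y; rewrite -(subrKA x) (le_trans (ler_normD _ _)) // [leRHS]splitr.
rewrite lerD //; last by near: y.
apply/fs_normP; split; first exact: ltW.
by move=> t M tM; rewrite fs_funB zh distrC; exact: xh.
Unshelve. all: by end_near. Qed.

HB.instance Definition _ := Uniform_isComplete.Build fs_type fs_type_complete.

End FunctionSpaceBanach.


                               

(** * Series in normed spaces *)

Section Series.
Variable K : numFieldType.

(** Comparison via the Cauchy criterion. Completeness is passed as an argument so that the lemma
    serves both Banach spaces and the field K. *)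
Lemma dominated_series_cvg (V : normedModType K)
    (Vc : forall F : set_system V, ProperFilter F -> cauchy F -> cvg F)
    (u : nat -> V) (w : nat -> K) (c : K) :
  0 < c -> (forall n, `|u n| <= c * w n) -> cvgn (series w) -> cvgn (series u).
Proof.
move=> c0 uw /cvg_cauchy/cauchy_seriesP wc.
apply: Vc; apply/cauchy_seriesP => e e0.
have ec : 0 < e / c by rewrite divr_gt0.
have := wc _ ec; apply: filterS => n wn.
have w0 k : 0 <= w k.
  by have := le_trans (normr_ge0 _) (uw k); rewrite pmulr_rge0.
rewrite (le_lt_trans (ler_norm_sum _ _ _)) //.
apply: (@le_lt_trans _ _ (c * \sum_(n.1 <= k < n.2) w k)).
  by rewrite mulr_sumr; apply: ler_sum.
rewrite mulrC -ltr_pdivlMr // (le_lt_trans _ wn) // real_ler_norm //.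
by rewrite ger0_real // sumr_ge0.
Qed.

Lemma bounded_additive_series (V W : normedModType K) (L : V -> W) (c : K)
    (u : nat -> V) :
  (forall x y, L (x + y) = L x + L y) -> (forall x, `|L x| <= c * `|x|) ->
  cvgn (series u) ->
  series (fun n => L (u n)) @ \oo --> L (limn (series u)).
Proof.
move=> LD Lc cu.
have L0 : L 0 = 0 by apply: (@addIr _ (L 0)); rewrite -LD !add0r.
have LB x y : L (x - y) = L x - L y.
  by apply: (@addIr _ (L y)); rewrite -LD !subrK.
have -> : series (fun n => L (u n)) = L \o series u.
  apply/funext => n; rewrite /series /=.
  by rewrite (big_morph L LD L0).
(* A strictly positive constant is needed to divide by, and [c] has no assumed sign. *)
have Lc1 x : `|L x| <= (`|c| + 1) * `|x|.
  rewrite mulrDl mul1r (le_trans (Lc x)) // (@le_trans _ _ `|c * `|x| |) //.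
    by rewrite real_ler_norm // ger0_real // (le_trans _ (Lc x)).
  by rewrite normrM normr_id lerDl.
have c1 : 0 < `|c| + 1 by rewrite ltr_wpDl.
apply/cvgrPdist_le => e e0.
have ec : 0 < e / (`|c| + 1) by rewrite divr_gt0.
move/cvgrPdist_le : cu => /(_ _ ec); apply: filterS => n.
by rewrite ler_pdivlMr // mulrC -LB; exact: le_trans.
Qed.

End Series.

(** * The unitization as a unital normed algebra *)

Section Unitization.
Variables (K : numFieldType) (A : completeNormedModType K) (mul : A -> A -> A).
Hypothesis Amul : banach_algebra mul.

Local Notation U := (A * K)%type.
Local Notation "x ** y" := (unit_mul mul x y) (at level 40).

Lemma unit_norm_ge0 (x : U) : 0 <= unit_norm x.
Proof. by rewrite /unit_norm addr_ge0. Qed.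

Lemma unit_normD (x y : U) : unit_norm (x + y) <= unit_norm x + unit_norm y.
Proof. by rewrite /unit_norm addrACA lerD // ler_normD. Qed.

Lemma unit_normZ k (x : U) : unit_norm (k *: x) = `|k| * unit_norm x.
Proof. by rewrite /unit_norm normrZ normrM mulrDr. Qed.

Lemma unit_normN (x : U) : unit_norm (- x) = unit_norm x.
Proof. by rewrite /unit_norm !normrN. Qed.

Lemma unit_norm_mul (x y : U) : unit_norm (x ** y) <= unit_norm x * unit_norm y.
Proof.
case: Amul => _ [_ [_ [_ [_ nM]]]].
rewrite /unit_norm /= mulrDl !mulrDr addrA -normrM lerD //.
rewrite (le_trans (ler_normD _ _)) // normrZ lerD //.
rewrite (le_trans (ler_normD _ _)) // normrZ [leRHS]addrC [leLHS]addrC.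
by rewrite lerD // mulrC.
Qed.

Lemma unit_mulDl (x y z : U) : (x + y) ** z = x ** z + y ** z.
Proof.
case: Amul => _ [mDl [_ [_ [_ _]]]].
congr pair => /=; last by rewrite mulrDl.
by rewrite mDl scalerDr scalerDl [LHS](AC (2*2*2) ((1*3*5)*(2*4*6))).
Qed.

Lemma unit_mulDr (x y z : U) : z ** (x + y) = z ** x + z ** y.
Proof.
case: Amul => _ [_ [mDr [_ [_ _]]]].
congr pair => /=; last by rewrite mulrDr.
by rewrite mDr scalerDr scalerDl [LHS](AC (2*2*2) ((1*3*5)*(2*4*6))).
Qed.

Lemma unit_mulZl k (x y : U) : (k *: x) ** y = k *: (x ** y).
Proof.
case: Amul => _ [_ [_ [mZl [_ _]]]].
congr pair => /=; last by rewrite -mulrA.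
by rewrite mZl !scalerDr !scalerA (mulrC k y.2).
Qed.

Lemma unit_mulZr k (x y : U) : y ** (k *: x) = k *: (y ** x).
Proof.
case: Amul => _ [_ [_ [_ [mZr _]]]].
congr pair => /=; last by rewrite [LHS]mulrCA.
by rewrite mZr !scalerDr !scalerA (mulrC k y.2).
Qed.

Lemma unit_mulNl (x y : U) : (- x) ** y = - (x ** y).
Proof. by rewrite -scaleN1r unit_mulZl scaleN1r. Qed.

Lemma unit_mulA (x y z : U) : x ** (y ** z) = x ** y ** z.
Proof.
case: Amul => mA [mDl [mDr [mZl [mZr _]]]].
congr pair => /=; last by rewrite mulrA.
rewrite !mDl !mDr !mZl !mZr mA !scalerDr !scalerA !addrA.
rewrite (mulrC z.2 y.2) (mulrC z.2 x.2).
by rewrite [LHS](ACl (1*3*5*2*4*6*7)).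
Qed.

Lemma unit_mule (x : U) : x ** unit_e A = x.
Proof.
case: Amul => _ [_ [_ [_ [mZr _]]]].
have m0 a : mul a 0 = 0 by have := mZr 0 a 0; rewrite !scale0r.
by case: x => a k; rewrite /unit_mul /= m0 scale1r scaler0 addr0 add0r mulr1.
Qed.

Lemma unit_emul (x : U) : unit_e A ** x = x.
Proof.
case: Amul => _ [_ [_ [mZl _]]].
have m0 a : mul 0 a = 0 by have := mZl 0 0 a; rewrite !scale0r.
by case: x => a k; rewrite /unit_mul /= m0 scale1r scaler0 addr0 add0r mul1r.
Qed.

Lemma unit_emb_mul a b : unit_emb a ** unit_emb b = unit_emb (mul a b).
Proof. by rewrite /unit_mul /= !scale0r !addr0 mul0r. Qed.

Lemma unit_norm_emb (a : A) : unit_norm (unit_emb a) = `|a|.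
Proof. by rewrite /unit_norm /= normr0 addr0. Qed.

End Unitization.

                    

(** * From nets of tensors to approximately semi-inner derivations *)

Definition norming_functionals (K : numFieldType) (V : normedModType K) :=
  forall x0 : V, exists f : V -> K,
    [/\ (forall k x y, f (k *: x + y) = k * f x + f y),
        (forall x, `|f x| <= `|x|) & `|x0| <= `|f x0|].

Section Sufficiency.
Variables (K : numFieldType) (A : completeNormedModType K) (mul : A -> A -> A).
Hypothesis Amul : banach_algebra mul.
Hypothesis Kc : complete_field K.
Variables (X : completeNormedModType K) (l : A -> X -> X) (r : X -> A -> X).
Hypothesis Xmod : banach_bimodule mul l r.
Hypothesis Xnorming : norming_functionals X.
Variable D : A -> X.
Hypothesis Dder : derivation mul l r D.
Hypothesis Dcont : continuous D.

Local Notation U := (A * K)%type.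
Local Notation "x ** y" := (unit_mul mul x y) (at level 40).

Definition unit_lact (x : U) (z : X) : X := l x.1 z + x.2 *: z.

(** This is x.D(y) for the extension of [D] with D(e) = 0, whence the scalar part of [y] drops
    out. *)
Definition left_derivation_form (x y : U) : X := unit_lact x (D y.1).

Local Notation psi := left_derivation_form.

Definition Psi (u : tensor_rep A) : X :=
  limn (series (fun n => psi (u n).1 (u n).2)).

Lemma derivation_bounded : exists2 M : K, 0 < M & forall a, `|D a| <= M * `|a|.
Proof.
case: Dder => DD DZ _.
have linD : linear D by move=> k x y; rewrite DD DZ.
pose DL : {linear A -> X} := HB.pack D (GRing.isLinear.Build _ _ _ _ D linD).
have /linear_bounded_continuous/linear_boundedP/pinfty_ex_gt0[M M0 DM] :
  continuous DL by [].
by exists M.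
Qed.

Lemma unit_lact_bounded : exists2 C : K, 0 < C &
  forall x z, `|unit_lact x z| <= C * unit_norm x * `|z|.
Proof.
case: Xmod => _ _ _ _ [C [C0 lC]].
exists (C + 1); first by rewrite addr_gt0.
move=> x z; rewrite (le_trans (ler_normD _ _)) // normrZ.
have [lx _] := lC x.1 z.
rewrite (le_trans (lerD lx (lexx _))) // -mulrDl ler_wpM2r //.
rewrite /unit_norm mulrDl mul1r mulrDr -addrA lerD2l.
by rewrite addrA lerDr addr_ge0 // mulr_ge0 // ltW.
Qed.

Lemma unit_lactDr x y z : unit_lact x (y + z) = unit_lact x y + unit_lact x z.
Proof.
case: Xmod => -[_ [lD _]] _ _ _ _.
by rewrite /unit_lact lD scalerDr addrACA.
Qed.

Lemma unit_lactDl x y z : unit_lact (x + y) z = unit_lact x z + unit_lact y z.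
Proof.
case: Xmod => -[lD _] _ _ _ _.
by rewrite /unit_lact lD scalerDl addrACA.
Qed.

Lemma unit_lactZl k x z : unit_lact (k *: x) z = k *: unit_lact x z.
Proof.
case: Xmod => -[_ [_ [lZ _]]] _ _ _ _.
by rewrite /unit_lact lZ scalerDr scalerA.
Qed.

Lemma unit_lactZr k x z : unit_lact x (k *: z) = k *: unit_lact x z.
Proof.
case: Xmod => -[_ [_ [_ lZ]]] _ _ _ _.
by rewrite /unit_lact lZ scalerDr !scalerA mulrC.
Qed.

Lemma unit_lactM x y z : unit_lact (x ** y) z = unit_lact x (unit_lact y z).
Proof.
case: Xmod => -[lDl [lDr [lZl lZr]]] _ [lM _] _ _.
rewrite /unit_lact /= !lDl !lDr !lZl !lZr lM scalerDr scalerA.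
by rewrite -!addrA.
Qed.

Lemma psiBl x x' y : psi (unit_sub x x') y = psi x y - psi x' y.
Proof.
rewrite /psi -[unit_sub _ _]/(x - x') unit_lactDl -scaleN1r unit_lactZl.
by rewrite scaleN1r.
Qed.

Lemma psiBr x y y' : psi x (unit_sub y y') = psi x y - psi x y'.
Proof.
case: Dder => DD DZ _.
by rewrite /psi /= DD unit_lactDr -scaleN1r DZ unit_lactZr scaleN1r.
Qed.

Lemma psi_lact a x y : psi (unit_emb a ** x) y = l a (psi x y).
Proof. by rewrite /psi unit_lactM {1}/unit_lact /= scale0r addr0. Qed.

(** The Leibniz rule for the extended derivation: x.D(ya) = xy.D(a) + (x.D(y)).a. Summed over a
    tensor, the first term produces pi(u).D(a). *)
Lemma psi_ract a x y :
  psi x (y ** unit_emb a) = unit_lact (x ** y) (D a) + r (psi x y) a.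
Proof.
case: Dder => DD DZ DM; case: Xmod => _ [_ [rD [_ rZ]]] _ lr _.
rewrite unit_lactM /psi /= scale0r addr0 DD DM DZ.
have -> : l y.1 (D a) + r (D y.1) a + y.2 *: D a =
    unit_lact y (D a) + r (D y.1) a by rewrite addrAC.
by rewrite unit_lactDr /unit_lact rD rZ lr.
Qed.

Lemma psi_bounded : exists2 N : K, 0 < N &
  forall x y, `|psi x y| <= N * (unit_norm x * unit_norm y).
Proof.
have [M M0 DM] := derivation_bounded; have [C C0 lC] := unit_lact_bounded.
exists (C * M); first by rewrite mulr_gt0.
move=> x y; rewrite (le_trans (lC _ _)) // mulrACA ler_wpM2l //.
  by rewrite mulr_ge0 ?unit_norm_ge0 // ltW.
by rewrite (le_trans (DM _)) // ler_wpM2l ?lerDl // ltW.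
Qed.

Lemma psi_cvg u : abs_summable u -> cvgn (series (fun n => psi (u n).1 (u n).2)).
Proof.
have [N N0 psiN] := psi_bounded.
by apply: (dominated_series_cvg (@cauchy_cvg X) N0) => n; exact: psiN.
Qed.

Lemma tensor_pi_cvg u : abs_summable u ->
  cvgn (series (fun n => ((u n).1 ** (u n).2).1)) /\
  cvgn (series (fun n => ((u n).1 ** (u n).2).2)).
Proof.
move=> su; have nM := unit_norm_mul Amul.
split; [apply: (dominated_series_cvg (@cauchy_cvg A) ltr01 _ su) |
        apply: (dominated_series_cvg Kc ltr01 _ su)] => n;
  by rewrite mul1r (le_trans _ (nM _ _)) // ?lerDl ?lerDr.
Qed.

Lemma Psi_lact_cvg a u : abs_summable u ->
  series (fun n => psi (tensor_lact mul a u n).1 (tensor_lact mul a u n).2)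
    @ \oo --> l a (Psi u).
Proof.
move=> /psi_cvg cu.
rewrite (_ : (fun n => _) = fun n => l a (psi (u n).1 (u n).2)); last first.
  by apply/funext => n; exact: psi_lact.
case: Xmod => -[_ [lD _]] _ _ _ [C [C0 lC]].
apply: (@bounded_additive_series _ _ _ (l a) (C * `|a|)) => //.
by move=> x; have [] := lC a x.
Qed.

Lemma Psi_ract_cvg a u : abs_summable u ->
  series (fun n => psi (tensor_ract mul u a n).1 (tensor_ract mul u a n).2)
    @ \oo --> unit_lact (tensor_pi mul u) (D a) + r (Psi u) a.
Proof.
move=> su; have cu := psi_cvg su; have [c1 c2] := tensor_pi_cvg su.
pose v n := (u n).1 ** (u n).2.
rewrite (_ : (fun n => _) = (fun n => l (v n).1 (D a)) +
    (fun n => (v n).2 *: D a) + (fun n => r (psi (u n).1 (u n).2) a)); last first.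
  by apply/funext => n; exact: psi_ract.
case: Xmod => -[lD _] [_ [rD _]] _ _ [C [C0 lrC]].
have serD (f g : nat -> X) : series (f + g) = series f + series g.
  by apply/funext => n; rewrite /series /= big_split.
rewrite 2!serD; apply: cvgD; first apply: cvgD.
- apply: (@bounded_additive_series _ _ _ (fun b => l b (D a)) (C * `|D a|)) => //.
  by move=> b; rewrite mulrAC; have [] := lrC b (D a).
- apply: (@bounded_additive_series _ K _ (fun k : K => k *: D a) `|D a|) => //.
    by move=> x y; rewrite scalerDl.
  by move=> k; rewrite normrZ mulrC.
- apply: (@bounded_additive_series _ _ _ (fun x => r x a) (C * `|a|)) => //.
  by move=> x; have [] := lrC a x.
Qed.

(** If [f] norms x - y, then the composite of [f] with [psi], divided by [N], lies in the unit ball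
    of bilinear forms, and its values at [v] and [w] are f(x)/N and f(y)/N. *)
Lemma Psi_tensor_bound N (v w : tensor_rep A) (x y : X) (e : K) : 0 < N ->
  (forall x y, `|psi x y| <= N * (unit_norm x * unit_norm y)) ->
  series (fun n => psi (v n).1 (v n).2) @ \oo --> x ->
  series (fun n => psi (w n).1 (w n).2) @ \oo --> y ->
  (forall phi, bil_form_unit_ball phi ->
     `|tensor_eval phi v - tensor_eval phi w| <= e) ->
  `|x - y| <= N * e.
Proof.
move=> N0 psiN vx wy vwe.
have [f [flin f1 fx]] := Xnorming (x - y).
have fD z w' : f (z + w') = f z + f w' by have := flin 1 z w'; rewrite scale1r mul1r.
have f0 : f 0 = 0 by apply: (@addIr _ (f 0)); rewrite -fD !add0r.
have fZ k z : f (k *: z) = k * f z by have := flin k z 0; rewrite f0 !addr0.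
have fN z : f (- z) = - f z by rewrite -scaleN1r fZ mulN1r.
pose L (z : X) : K := N^-1 * f z.
have LD z z' : L (z + z') = L z + L z' by rewrite /L fD mulrDr.
have LZ k z : L (k *: z) = k * L z by rewrite /L fZ mulrCA.
have LB z z' : L (z - z') = L z - L z' by rewrite LD /L fN mulrN.
have LN z : `|L z| <= N^-1 * `|z|.
  by rewrite normrM (gtr0_norm (x := N^-1)) ?invr_gt0 // ler_wpM2l // invr_ge0 ltW.
pose phi x y := L (psi x y).
have phiP : bil_form_unit_ball phi.
  case: Dder => DD DZ _; split.
  - by move=> x1 x2 z; rewrite /phi psiBl LB.
  - by move=> x1 z z'; rewrite /phi psiBr LB.
  - move=> k x1 z; rewrite /phi /psi -[(_, _)]/(k *: x1) unit_lactZl LZ //.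
  - by move=> k x1 z; rewrite /phi /psi /= DZ unit_lactZr LZ.
  - move=> x1 z; rewrite (le_trans (LN _)) // -(ler_pM2l N0) mulrA divff ?gt_eqF //.
    by rewrite mul1r.
have eval_lim (t : tensor_rep A) (z : X) :
    series (fun n => psi (t n).1 (t n).2) @ \oo --> z -> tensor_eval phi t = L z.
  move=> tz; apply: cvg_lim => //.
  rewrite -(cvg_lim (@norm_hausdorff _ _) tz).
  apply: (@bounded_additive_series _ X K L N^-1) => //.
  by apply/cvg_ex; exists z.
have := vwe _ phiP; rewrite (eval_lim _ _ vx) (eval_lim _ _ wy) -LB /L normrM.
rewrite (gtr0_norm (x := N^-1)) ?invr_gt0 // ler_pdivrMl //.
exact: le_trans.
Qed.

Lemma approx_diagonal_semi_inner (I : Type) (le : I -> I -> Prop)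
    (xi eta : I -> tensor_rep A) :
  directed le ->
  (forall i, abs_summable (xi i)) -> (forall i, abs_summable (eta i)) ->
  (forall a : A, tensor_net_diff_to0 le (fun i => tensor_lact mul a (xi i))
                   (fun i => tensor_ract mul (eta i) a)) ->
  pi_net_to_e mul le eta ->
  approx_semi_inner l r D.
Proof.
move=> dir sxi seta diff pie; exists I, le; split => //.
exists (fun i => Psi (xi i)), (fun i => Psi (eta i)) => a e e0.
have [N N0 psiN] := psi_bounded; have [C C0 lC] := unit_lact_bounded.
have e1 : 0 < e / 2 / N by rewrite !divr_gt0.
(* Half of the error comes from Psi(a.xi) - Psi(eta.a), the other half from (pi(eta) - e).D(a); the
   added 1 covers D(a) = 0. *)
have e2 : 0 < e / 2 / (C * (`|D a| + 1)).
  by rewrite !divr_gt0 // mulr_gt0 // ltr_wpDl.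
have [i1 di1] := diff a _ e1; have [i2 pi2] := pie _ e2.
have [_ _ le_trans_ dir_] := dir; have [i0 [i10 i20]] := dir_ i1 i2.
exists i0 => i ii0.
have := di1 i (le_trans_ _ _ _ i10 ii0).
have := pi2 i (le_trans_ _ _ _ i20 ii0).
set s := unit_sub _ _ => se.
move/(Psi_tensor_bound N0 psiN (Psi_lact_cvg (a := a) (sxi i))
  (Psi_ract_cvg (a := a) (seta i))).
rewrite mulrC divfK ?gt_eqF // => de.
have unit_lact_e z : unit_lact (unit_e A) z = z.
  case: Xmod => -[_ [_ [lZ _]]] _ _ _ _.
  by rewrite /unit_lact /= scale1r -(scale0r 0) lZ scale0r add0r.
have piE : unit_lact (tensor_pi mul (eta i)) (D a) = unit_lact s (D a) + D a.
  rewrite -[X in _ + X]unit_lact_e -unit_lactDl.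
  by rewrite -[s]/(tensor_pi mul (eta i) - unit_e A) subrK.
rewrite piE in de; rewrite [leRHS]splitr.
have regroup (x y z w : X) : x - y - w = (x - (z + w + y)) + z.
  by rewrite !opprD !addrA [RHS](ACl (1*4*3*(5*2))) /= subrr addr0.
rewrite (regroup _ _ (unit_lact s (D a))).
rewrite (le_trans (ler_normD _ _)) // lerD // (le_trans (lC _ _)) //.
rewrite mulrAC (@le_trans _ _ (C * (`|D a| + 1) * unit_norm s)) //.
  by rewrite ler_wpM2r ?unit_norm_ge0 // ler_wpM2l ?lerDl // ltW.
by rewrite mulrC -ler_pdivlMr // mulr_gt0 // ltr_wpDl.
Qed.

End Sufficiency.

                  

(** * The kernel of the product map as a Banach bimodule *)

Section Necessity.
Variables (K : numFieldType) (A : completeNormedModType K) (mul : A -> A -> A).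
Hypothesis Amul : banach_algebra mul.

Local Notation U := (A * K)%type.
Local Notation "x ** y" := (unit_mul mul x y) (at level 40).

Definition form_bound (phi : U -> U -> K) (M : K) :=
  [/\ 0 < M,
      (forall k x x' y, phi (k *: x + x') y = k * phi x y + phi x' y),
      (forall k x y y', phi x (k *: y + y') = k * phi x y + phi x y') &
      (forall x y, `|phi x y| <= M * (unit_norm x * unit_norm y))].

Lemma ball_form_bound phi : bil_form_unit_ball phi -> form_bound phi 1.
Proof.
case=> phiBl phiBr phiZl phiZr phi1.
have phi0l y : phi 0 y = 0.
  by have := phiBl 0 0 y; rewrite -[unit_sub _ _]/(0 - 0 : U) !subrr.
have phi0r x : phi x 0 = 0.
  by have := phiBr x 0 0; rewrite -[unit_sub _ _]/(0 - 0 : U) !subrr.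
have phiNl x y : phi (- x) y = - phi x y.
  by have := phiBl 0 x y; rewrite -[unit_sub _ _]/(0 - x : U) !sub0r phi0l sub0r.
have phiNr x y : phi x (- y) = - phi x y.
  by have := phiBr x 0 y; rewrite -[unit_sub _ _]/(0 - y : U) !sub0r phi0r sub0r.
split => //.
- move=> k x x' y; rewrite -[k * _]phiZl -[(_, _)]/(k *: x : U).
  have := phiBl (k *: x) (- x') y.
  by rewrite -[unit_sub _ _]/(k *: x - - x' : U) phiNl !opprK.
- move=> k x y y'; rewrite -[k * _]phiZr -[(_, _)]/(k *: y : U).
  have := phiBr x (k *: y) (- y').
  by rewrite -[unit_sub _ _]/(k *: y - - y' : U) phiNr !opprK.
- by move=> x y; rewrite mul1r.
Qed.

Definition bounded_form := {phi : U -> U -> K | exists M, form_bound phi M}.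

Lemma form_linear (phi : bounded_form) :
  [/\ (forall k x x' y, sval phi (k *: x + x') y = k * sval phi x y + sval phi x' y) &
      (forall k x y y', sval phi x (k *: y + y') = k * sval phi x y + sval phi x y')].
Proof. by case: phi => phi [M []]. Qed.

Lemma formDl (phi : bounded_form) x x' y :
  sval phi (x + x') y = sval phi x y + sval phi x' y.
Proof. by have [/(_ 1 x x' y)] := form_linear phi; rewrite scale1r mul1r. Qed.

Lemma formDr (phi : bounded_form) x y y' :
  sval phi x (y + y') = sval phi x y + sval phi x y'.
Proof. by have [_ /(_ 1 x y y')] := form_linear phi; rewrite scale1r mul1r. Qed.

Lemma form0l (phi : bounded_form) y : sval phi 0 y = 0.
Proof. by apply: (@addIr _ (sval phi 0 y)); rewrite -formDl !add0r. Qed.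

Lemma form0r (phi : bounded_form) x : sval phi x 0 = 0.
Proof. by apply: (@addIr _ (sval phi x 0)); rewrite -formDr !add0r. Qed.

Lemma formZl (phi : bounded_form) k x y : sval phi (k *: x) y = k * sval phi x y.
Proof.
by have [/(_ k x 0 y) + _] := form_linear phi; rewrite form0l !addr0.
Qed.

Lemma formZr (phi : bounded_form) k x y : sval phi x (k *: y) = k * sval phi x y.
Proof.
by have [_ /(_ k x y 0)] := form_linear phi; rewrite form0r !addr0.
Qed.

Lemma formNl (phi : bounded_form) x y : sval phi (- x) y = - sval phi x y.
Proof. by rewrite -scaleN1r formZl mulN1r. Qed.

                                                                           
(** A finite sequence of pairs stands for a finite sum of elementary tensors. No quotient is formed:
    tensors are compared through their values on bounded forms. *)
Definition ften_eval (u : seq (U * U)) (phi : U -> U -> K) : K :=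
  \sum_(p <- u) phi p.1 p.2.

Definition ften_pi (u : seq (U * U)) : U := \sum_(p <- u) p.1 ** p.2.

Definition ften_scale (k : K) (u : seq (U * U)) := [seq (k *: p.1, p.2) | p <- u].

Lemma ften_eval_scale k u (phi : bounded_form) :
  ften_eval (ften_scale k u) (sval phi) = k * ften_eval u (sval phi).
Proof.
by rewrite /ften_eval big_map mulr_sumr; apply: eq_bigr => p _; rewrite formZl.
Qed.

Lemma ften_pi_scale k u : ften_pi (ften_scale k u) = k *: ften_pi u.
Proof.
rewrite /ften_pi big_map scaler_sumr; apply: eq_bigr => p _.
by rewrite unit_mulZl.
Qed.

Lemma ften_eval_bound u phi M : form_bound phi M ->
  `|ften_eval u phi| <= (\sum_(p <- u) unit_norm p.1 * unit_norm p.2) * M.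
Proof.
case=> _ _ _ phiM; rewrite (le_trans (ler_norm_sum _ _ _)) // mulr_suml.
by apply: ler_sum => p _; rewrite mulrC.
Qed.

                                                                           
                                                                             
(** This is the image of ker pi in the bidual of the projective tensor product. Smallness of the
    products of the approximants encodes pi = 0 in the completion, where pi itself is not defined
    here. *)
Definition kernel_functional : set (bounded_form -> K^o) :=
  [set F | forall e : K, 0 < e -> exists u,
    unit_norm (ften_pi u) <= e /\
    forall (phi : bounded_form) M, form_bound (sval phi) M ->
      `|(F phi : K) - ften_eval u (sval phi)| <= e * M].

Lemma form_bound_gt0 phi M : form_bound phi M -> 0 < M.
Proof. by case. Qed.

Lemma kernel_functional_submod : kernel_functional 0 /\
  forall k f g, kernel_functional f -> kernel_functional g ->
    kernel_functional (k *: f + g).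
Proof.
split.
  move=> e e0; exists [::]; rewrite /ften_pi /ften_eval big_nil; split.
    by rewrite /unit_norm !normr0 addr0 ltW.
  move=> phi M /form_bound_gt0 M0.
  by rewrite big_nil subrr normr0 mulr_ge0 // ltW.
move=> k f g Hf Hg e e0.
have k0 : 0 < `|k| + 1 by rewrite ltr_wpDl.
have e2 : 0 < e / 2 by rewrite divr_gt0.
have e2k : 0 < e / 2 / (`|k| + 1) by rewrite divr_gt0.
have ke : `|k| * (e / 2 / (`|k| + 1)) <= e / 2.
  by rewrite mulrCA ler_piMr ?(ltW e2) // ler_pdivrMr // mul1r lerDl.
have [u [piu uf]] := Hf _ e2k; have [v [piv vg]] := Hg _ e2.
exists (ften_scale k u ++ v); split.
  rewrite /ften_pi big_cat -/(ften_pi _) -/(ften_pi _) ften_pi_scale.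
  rewrite (le_trans (unit_normD _ _)) // [leRHS]splitr lerD //.
  by rewrite unit_normZ (le_trans _ ke) // ler_wpM2l.
move=> phi M phiM; have M0 := form_bound_gt0 phiM.
rewrite /ften_eval big_cat -/(ften_eval _ _) -/(ften_eval _ _) ften_eval_scale.
rewrite -[(k *: f + g) phi]/(k * f phi + g phi) opprD addrACA -mulrBr.
rewrite (le_trans (ler_normD _ _)) // (splitr e) mulrDl lerD //; last exact: vg.
rewrite normrM (@le_trans _ _ (`|k| * (e / 2 / (`|k| + 1) * M))) //.
  by rewrite ler_wpM2l //; exact: uf.
by rewrite mulrA ler_wpM2r // ltW.
Qed.

Lemma kernel_functional_bounded f : kernel_functional f ->
  exists c, forall (phi : bounded_form) M, form_bound (sval phi) M ->
    `|f phi| <= c * M.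
Proof.
move=> /(_ 1 ltr01)[u [_ uf]].
exists (\sum_(p <- u) unit_norm p.1 * unit_norm p.2 + 1) => phi M phiM.
rewrite -[f phi](subrK (ften_eval u (sval phi) : K^o)) addrC.
rewrite (le_trans (ler_normD _ _)) // mulrDl lerD //; last exact: uf.
exact: ften_eval_bound.
Qed.

Lemma kernel_functional_closed f :
  (forall e, 0 < e -> exists2 g, kernel_functional g &
     forall (phi : bounded_form) M, form_bound (sval phi) M ->
       `|f phi - g phi| <= e * M) -> kernel_functional f.
Proof.
move=> fg e e0; have e2 : 0 < e / 2 by rewrite divr_gt0.
have [g Hg fge] := fg _ e2; have [u [piu ug]] := Hg _ e2.
exists u; split.
  by rewrite (le_trans piu) // ler_pdivrMr // ler_peMr ?ler1n // ltW.
move=> phi M phiM.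
rewrite -(subrKA (g phi)) (le_trans (ler_normD _ _)) // (splitr e) mulrDl.
by apply: lerD; [exact: fge|exact: ug].
Qed.

(** A map [op_l] (x) [op_r] on tensors that covers [op_pi] under the product map, and so preserves
    the kernel. Left and right multiplications by elements of A are both instances; on functionals
    such an operator acts by pulling forms back. *)
Record tensor_operator := TensorOperator {
  op_l : U -> U;
  op_r : U -> U;
  op_pi : U -> U;
  op_bound : K;
  op_bound_gt0 : 0 < op_bound;
  op_lP : forall k x y, op_l (k *: x + y) = k *: op_l x + op_l y;
  op_rP : forall k x y, op_r (k *: x + y) = k *: op_r x + op_r y;
  op_piD : forall x y, op_pi (x + y) = op_pi x + op_pi y;
  op_mul : forall x y, op_l x ** op_r y = op_pi (x ** y);
  op_lr_bound : forall x y, unit_norm (op_l x) * unit_norm (op_r y) <=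
    op_bound * (unit_norm x * unit_norm y);
  op_pi_bound : forall x, unit_norm (op_pi x) <= op_bound * unit_norm x }.

Section Pullback.
Variable T : tensor_operator.

Definition pull (phi : U -> U -> K) x y := phi (op_l T x) (op_r T y).

Lemma pull_bound phi M : form_bound phi M ->
  form_bound (pull phi) (M * op_bound T).
Proof.
case=> M0 phil phir phiM; have c0 := op_bound_gt0 T; split.
- by rewrite mulr_gt0.
- by move=> k x x' y; rewrite /pull op_lP phil.
- by move=> k x y y'; rewrite /pull op_rP phir.
- move=> x y; rewrite (le_trans (phiM _ _)) // -mulrA ler_wpM2l ?op_lr_bound //.
  exact: ltW.
Qed.

Lemma pull_bounded (phi : bounded_form) : exists M, form_bound (pull (sval phi)) M.
Proof.
by case: phi => phi [M phiM]; exists (M * op_bound T); exact: pull_bound.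
Qed.

Definition pull_form (phi : bounded_form) : bounded_form :=
  exist _ (pull (sval phi)) (pull_bounded phi).

Definition ften_op (u : seq (U * U)) := [seq (op_l T p.1, op_r T p.2) | p <- u].

Lemma ften_op_eval u phi : ften_eval (ften_op u) phi = ften_eval u (pull phi).
Proof. by rewrite /ften_eval big_map. Qed.

Lemma ften_op_pi u : ften_pi (ften_op u) = op_pi T (ften_pi u).
Proof.
have op_pi0 : op_pi T 0 = 0.
  by apply: (@addIr _ (op_pi T 0)); rewrite -op_piD !add0r.
rewrite /ften_pi big_map (big_morph _ (@op_piD T) op_pi0).
by apply: eq_bigr => p _; rewrite op_mul.
Qed.

Lemma kernel_functional_pull F : kernel_functional F ->
  kernel_functional (fun phi => F (pull_form phi)).
Proof.
have c0 := op_bound_gt0 T.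
move=> HF e e0; have ec : 0 < e / op_bound T by rewrite divr_gt0.
have [u [piu uF]] := HF _ ec; exists (ften_op u); split.
  rewrite ften_op_pi (le_trans (op_pi_bound _ _)) // mulrC.
  by rewrite -ler_pdivlMr.
move=> phi M phiM; rewrite ften_op_eval.
rewrite (le_trans (uF (pull_form phi) _ (pull_bound phiM))) //.
by rewrite mulrCA divfK ?gt_eqF // mulrC.
Qed.

End Pullback.

Hypothesis Kc : complete_field K.
Hypothesis Klub : nonneg_lub_property K.

Definition tensor_kernel : function_space K :=
  @FunctionSpace K bounded_form (fun phi M => form_bound (sval phi) M)
    kernel_functional Kc Klub (fun phi M => @form_bound_gt0 (sval phi) M)
    (fun phi => svalP phi) kernel_functional_submod kernel_functional_bounded
    kernel_functional_closed.

Local Notation X := (fs_type tensor_kernel).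

Definition kernel_op (T : tensor_operator) (x : X) : X :=
  @FsElt K tensor_kernel (fun phi => fs_fun x (pull_form T phi) : K^o)
    (asboolT (kernel_functional_pull T (fs_funP x))).

Lemma kernel_opE T x phi : fs_fun (kernel_op T x) phi = fs_fun x (pull_form T phi).
Proof. by []. Qed.

Lemma kernel_ext (x y : X) : (forall phi, fs_fun x phi = fs_fun y phi) -> x = y.
Proof. by move=> xy; apply: val_inj; apply/funext. Qed.

(** Elements of X are a priori arbitrary functions of the form; linearity is inherited from the
    evaluations at finite tensors that approximate them. It makes the module actions linear in the
    algebra variable, on which the pulled-back form depends linearly. *)
Lemma kernel_fun_linear (x : X) k (phi phi1 phi2 : bounded_form) :
  (forall a b, sval phi a b = k * sval phi1 a b + sval phi2 a b) ->
  fs_fun x phi = k * fs_fun x phi1 + fs_fun x phi2.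
Proof.
move=> phiE.
have [M phiM] := svalP phi; have [M1 phiM1] := svalP phi1.
have [M2 phiM2] := svalP phi2.
have := form_bound_gt0 phiM; have := form_bound_gt0 phiM1.
have := form_bound_gt0 phiM2 => M20 M10 M0.
(* With tolerance e / c, the errors at [phi], [phi1] (times |k|) and [phi2] add up to exactly
   [e]. *)
pose c := M + `|k| * M1 + M2.
have c0 : 0 < c by rewrite ltr_wpDl // addr_ge0 ?mulr_ge0 // ltW.
apply/eqP; rewrite -subr_eq0 -normr_le0; apply/ler_addgt0Pr => e e0; rewrite add0r.
have ec : 0 < e / c by rewrite divr_gt0.
have [u [_ ux]] := fs_funP x _ ec.
have uE : ften_eval u (sval phi) =
    k * ften_eval u (sval phi1) + ften_eval u (sval phi2).
  by rewrite /ften_eval mulr_sumr -big_split; apply: eq_bigr.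
have {ux} := (ux _ _ phiM, ux _ _ phiM1, ux _ _ phiM2).
set a := fs_fun x phi; set a1 := fs_fun x phi1; set a2 := fs_fun x phi2.
rewrite uE; set v1 := ften_eval u _; set v2 := ften_eval u _ => -[[xa xa1] xa2].
have -> : (a : K) - (k * a1 + a2) =
    (a - (k * v1 + v2)) - (k * (a1 - v1)) - (a2 - v2) by ring.
rewrite (le_trans (ler_normB _ _)) //.
rewrite (le_trans (lerD (ler_normB _ _) (lexx _))) // normrM.
have -> : e = e / c * M + `|k| * (e / c * M1) + e / c * M2.
  by rewrite mulrCA -!mulrDr /c divfK ?gt_eqF.
by rewrite !lerD // ler_wpM2l.
Qed.

Lemma kernel_op_bound T x : `|kernel_op T x| <= op_bound T * `|x|.
Proof.
apply/fs_normP; split; first by rewrite mulr_ge0 // ltW // op_bound_gt0.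
move=> phi M phiM; rewrite kernel_opE (mulrC (op_bound T)) -mulrA (mulrC _ M).
exact: (@fs_fun_le K tensor_kernel x (pull_form T phi) _ (pull_bound T phiM)).
Qed.

Lemma unit_lmul_linear (z : U) k x y : z ** (k *: x + y) = k *: (z ** x) + z ** y.
Proof. by rewrite unit_mulDr // unit_mulZr. Qed.

Lemma unit_rmul_linear (z : U) k x y : (k *: x + y) ** z = k *: (x ** z) + y ** z.
Proof. by rewrite unit_mulDl // unit_mulZl. Qed.

Lemma norm_plus1_gt0 (a : A) : 0 < `|a| + 1.
Proof. by rewrite ltr_wpDl. Qed.

Lemma unit_emb_lmul_bound a x :
  unit_norm (unit_emb a ** x) <= (`|a| + 1) * unit_norm x.
Proof.
rewrite (le_trans (unit_norm_mul Amul _ _)) // unit_norm_emb.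
by rewrite ler_wpM2r ?unit_norm_ge0 // lerDl.
Qed.

Lemma unit_emb_rmul_bound a x :
  unit_norm (x ** unit_emb a) <= (`|a| + 1) * unit_norm x.
Proof.
rewrite (le_trans (unit_norm_mul Amul _ _)) // unit_norm_emb mulrC.
by rewrite ler_wpM2r ?unit_norm_ge0 // lerDl.
Qed.

(** The bound is |a| + 1 rather than |a| because [op_bound] must be positive, also at a = 0. *)
Definition left_operator (a : A) : tensor_operator.
Proof.
refine (@TensorOperator (fun x => unit_emb a ** x) id (fun x => unit_emb a ** x)
  (`|a| + 1) (norm_plus1_gt0 a) (@unit_lmul_linear _) _ _ _ _
  (unit_emb_lmul_bound a)) => //.
- by move=> x y; rewrite unit_mulDr.
- by move=> x y; rewrite unit_mulA.
- by move=> x y; rewrite mulrA ler_wpM2r ?unit_norm_ge0 // unit_emb_lmul_bound.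
Defined.

Definition right_operator (a : A) : tensor_operator.
Proof.
refine (@TensorOperator id (fun x => x ** unit_emb a) (fun x => x ** unit_emb a)
  (`|a| + 1) (norm_plus1_gt0 a) _ (@unit_rmul_linear _) _ _ _
  (unit_emb_rmul_bound a)) => //.
- by move=> x y; rewrite unit_mulDl.
- by move=> x y; rewrite unit_mulA.
- by move=> x y; rewrite mulrCA ler_wpM2l ?unit_norm_ge0 // unit_emb_rmul_bound.
Defined.

Definition kernel_lact (a : A) (x : X) : X := kernel_op (left_operator a) x.
Definition kernel_ract (x : X) (a : A) : X := kernel_op (right_operator a) x.

Lemma unit_embP k (a b : A) : unit_emb (k *: a + b) = k *: unit_emb a + unit_emb b.
Proof. by congr pair => /=; rewrite scaler0 addr0. Qed.

Lemma kernel_lact_linear k a b x :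
  kernel_lact (k *: a + b) x = k *: kernel_lact a x + kernel_lact b x.
Proof.
apply: kernel_ext => phi; rewrite fs_funD fs_funZ !kernel_opE.
apply: kernel_fun_linear => y z /=; rewrite /pull /= unit_embP.
by rewrite unit_rmul_linear formDl formZl.
Qed.

Lemma kernel_ract_linear k a b x :
  kernel_ract x (k *: a + b) = k *: kernel_ract x a + kernel_ract x b.
Proof.
apply: kernel_ext => phi; rewrite fs_funD fs_funZ !kernel_opE.
apply: kernel_fun_linear => y z /=; rewrite /pull /= unit_embP.
by rewrite unit_lmul_linear formDr formZr.
Qed.

                                                                              
(** Homogeneity removes the spurious 1 in |a| + 1: on a vector of norm 1 the bound reads 2 * |x|,
    and scaling back gives the general case. *)
Lemma homogeneous_bound (h : A -> X) (x : X) :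
  (forall k a b, h (k *: a + b) = k *: h a + h b) ->
  (forall a, `|h a| <= (`|a| + 1) * `|x|) ->
  forall a, `|h a| <= 2 * `|a| * `|x|.
Proof.
move=> hlin hb a.
have h0 : h 0 = 0.
  by apply: (@addIr _ (h 0)); rewrite -[X in X + _]scale1r -hlin scaler0 !add0r.
have [->|a0] := eqVneq a 0; first by rewrite h0 !normr0 mulr0 mul0r.
have na0 : `|a| != 0 by rewrite normr_eq0.
have aE : a = `|a| *: (`|a|^-1 *: a) + 0 by rewrite scalerA divff // scale1r addr0.
rewrite {1}aE hlin h0 addr0.
rewrite normrZ normr_id (mulrC 2) -mulrA ler_wpM2l // (le_trans (hb _)) //.
by rewrite normrZ normfV normr_id mulVf.
Qed.

Lemma kernel_bimodule : banach_bimodule mul kernel_lact kernel_ract.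
Proof.
split.
- split; first by move=> a b x; have := kernel_lact_linear 1 a b x; rewrite !scale1r.
  split; first by move=> a x y; apply: kernel_ext.
  split; last by move=> k a x; apply: kernel_ext.
  (* Homogeneity is linearity with second argument 0, once 0 is known to act as 0; that follows from
     linearity at 1, 0, 0. *)
  move=> k a x; have := kernel_lact_linear k a 0 x.
  have := kernel_lact_linear 1 0 0 x; rewrite !scale1r !addr0 => /eqP.
  by rewrite -subr_eq0 opprD addNKr oppr_eq0 => /eqP -> ->; rewrite addr0.
- split; first by move=> a b x; have := kernel_ract_linear 1 a b x; rewrite !scale1r.
  split; first by move=> a x y; apply: kernel_ext.
  split; last by move=> k a x; apply: kernel_ext.
  move=> k a x; have := kernel_ract_linear k a 0 x.
  have := kernel_ract_linear 1 0 0 x; rewrite !scale1r !addr0 => /eqP.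
  by rewrite -subr_eq0 opprD addNKr oppr_eq0 => /eqP -> ->; rewrite addr0.
- split => a b x; apply: kernel_ext => phi; rewrite !kernel_opE; congr (fs_fun x _);
    apply: eq_exist; apply/funext => y; apply/funext => z; rewrite /pull /= /pull /=;
    by rewrite -unit_emb_mul unit_mulA.
- by move=> a b x; apply: kernel_ext => phi; rewrite !kernel_opE; congr (fs_fun x _);
    apply: eq_exist.
- exists 2; split => // a x; split.
    apply: (homogeneous_bound (h := kernel_lact ^~ x)) => [k b c|b].
      exact: kernel_lact_linear.
    exact: kernel_op_bound.
  apply: (homogeneous_bound (h := kernel_ract x)) => [k b c|b].
    exact: kernel_ract_linear.
  exact: kernel_op_bound.
Qed.

Local Notation e := (unit_e A).

(** The functional is evaluation at a (x) e - e (x) a, whose product is a - a = 0, so this one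
    tensor serves every tolerance. *)
Lemma diagonal_derivation_mem a :
  kernel_functional
    (fun phi => sval phi (unit_emb a) e - sval phi e (unit_emb a) : K^o).
Proof.
move=> d d0; exists [:: (unit_emb a, e); (- e, unit_emb a)]; split.
  rewrite /ften_pi big_cons big_seq1 /= unit_mule // unit_mulNl // unit_emul //.
  by rewrite subrr /unit_norm !normr0 addr0 ltW.
move=> phi M /form_bound_gt0 M0.
rewrite /ften_eval big_cons big_seq1 /= formNl subrr normr0.
by rewrite mulr_ge0 // ltW.
Qed.

Definition diagonal_derivation (a : A) : X :=
  @FsElt K tensor_kernel _ (asboolT (diagonal_derivation_mem a)).

Lemma diagonal_derivationE a phi : fs_fun (diagonal_derivation a) phi =
  sval phi (unit_emb a) e - sval phi e (unit_emb a).
Proof. by []. Qed.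

Lemma diagonal_derivation_linear k a b : diagonal_derivation (k *: a + b) =
  k *: diagonal_derivation a + diagonal_derivation b.
Proof.
apply: kernel_ext => phi; rewrite fs_funD fs_funZ !diagonal_derivationE unit_embP.
by rewrite formDl formZl formDr formZr; ring.
Qed.

Lemma diagonal_derivationP :
  derivation mul kernel_lact kernel_ract diagonal_derivation.
Proof.
split.
- by move=> a b; have := diagonal_derivation_linear 1 a b; rewrite !scale1r.
- move=> k a; apply: kernel_ext => phi; rewrite fs_funZ !diagonal_derivationE.
  have -> : unit_emb (k *: a) = k *: unit_emb a by congr pair; rewrite /= scaler0.
  by rewrite formZl formZr mulrBr.
- move=> a b; apply: kernel_ext => phi; rewrite fs_funD !kernel_opE.
  rewrite !diagonal_derivationE /= /pull /= !unit_emb_mul unit_mule // unit_emul //.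
  by rewrite addrA subrK.
Qed.

Lemma unit_norm_e : unit_norm e = 1.
Proof. by rewrite /unit_norm normr0 normr1 add0r. Qed.

Lemma diagonal_derivation_bound a : `|diagonal_derivation a| <= 2 * `|a|.
Proof.
apply/fs_normP; split; first by rewrite mulr_ge0.
move=> phi M [M0 _ _ phiM]; rewrite diagonal_derivationE.
rewrite (le_trans (ler_normB _ _)) //.
rewrite (le_trans (lerD (phiM _ _) (phiM _ _))) //.
by rewrite unit_norm_e unit_norm_emb mulr1 mul1r -mulrA mulr_natl mulr2n (mulrC M).
Qed.

Lemma diagonal_derivation_continuous : continuous diagonal_derivation.
Proof.
move=> a; apply/cvgrPdist_le => d d0; near=> b.
have -> : diagonal_derivation a - diagonal_derivation b = diagonal_derivation (a - b).
  by rewrite [a - b]addrC -[- b]scaleN1r diagonal_derivation_linear scaleN1r addrC.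
rewrite (le_trans (diagonal_derivation_bound _)) // mulrC -ler_pdivlMr //.
by near: b; apply: cvgr_dist_le => //; rewrite divr_gt0.
Unshelve. all: by end_near. Qed.

End Necessity.

(** * From semi-contractibility to nets of tensors *)

(** Beyond the length of [u], [nth] returns the default [x0], whose contribution vanishes, so the
    partial sums are eventually constant. *)
Lemma finite_series_cvg (K : numFieldType) (V : normedModType K) (T : Type)
    (x0 : T) (u : seq T) (g : T -> V) : g x0 = 0 ->
  series (fun n => g (nth x0 u n)) @ \oo --> \sum_(x <- u) g x.
Proof.
move=> g0; apply: cvg_near_cst; exists (size u) => // n /= un.
rewrite /series /= [RHS](big_nth x0) (big_cat_nat (leq0n _) un) /=.
rewrite [X in _ + X]big_nat_cond [X in _ + X]big1 ?addr0 // => i.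
by rewrite andbT => /andP[ui _]; rewrite nth_default.
Qed.

Section NecessityNets.
Variables (K : numFieldType) (A : completeNormedModType K) (mul : A -> A -> A).
Hypothesis Amul : banach_algebra mul.
Hypothesis Kc : complete_field K.
Hypothesis Klub : nonneg_lub_property K.

Local Notation U := (A * K)%type.
Local Notation "x ** y" := (unit_mul mul x y) (at level 40).
Local Notation e := (unit_e A).
Local Notation X := (fs_type (tensor_kernel Amul Kc Klub)).
Local Notation D := (diagonal_derivation Amul Kc Klub).

Definition ften_rep (u : seq (U * U)) : tensor_rep A := nth (0, 0) u.

(** The tensor e (x) e - u, which turns a small product into a product near e. *)
Definition unit_minus (u : seq (U * U)) : seq (U * U) :=
  (e, e) :: ften_scale (-1) u.

Lemma ften_rep_summable u : abs_summable (ften_rep u).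
Proof.
apply/cvg_ex; exists (\sum_(p <- u) unit_norm p.1 * unit_norm p.2).
apply: (finite_series_cvg (g := fun p => unit_norm p.1 * unit_norm p.2)).
by rewrite /unit_norm /= !normr0 addr0 mul0r.
Qed.

Lemma unit_mul00 : (0 : U) ** 0 = 0.
Proof. by rewrite -(scale0r (0 : U)) unit_mulZl // !scale0r. Qed.

Lemma ften_rep_pi u : tensor_pi mul (ften_rep u) = ften_pi mul u.
Proof.
have fstM : {morph (@fst A K) : x y / x + y >-> x + y} by [].
have sndM : {morph (@snd A K) : x y / x + y >-> x + y} by [].
rewrite [RHS]surjective_pairing /ften_pi.
rewrite (big_morph _ fstM (erefl _)) (big_morph _ sndM (erefl _)).
congr pair; apply: cvg_lim => //.
  apply: (finite_series_cvg (g := fun p => (p.1 ** p.2).1)).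
  by rewrite unit_mul00.
apply: (@finite_series_cvg K K _ _ _ (fun p => (p.1 ** p.2).2)).
by rewrite unit_mul00.
Qed.

Lemma unit_minus_pi u : ften_pi mul (unit_minus u) = e - ften_pi mul u.
Proof.
rewrite {1}/ften_pi big_cons -[X in _ + X]/(ften_pi mul (ften_scale (-1) u)).
rewrite ften_pi_scale //.
by rewrite scaleN1r /= unit_mule.
Qed.

Lemma unit_minus_eval u (phi : bounded_form A) :
  ften_eval (unit_minus u) (sval phi) = sval phi e e - ften_eval u (sval phi).
Proof.
rewrite {1}/ften_eval big_cons.
rewrite -[X in _ + X]/(ften_eval (ften_scale (-1) u) (sval phi)).
by rewrite ften_eval_scale mulN1r.
Qed.

(** Acting on a tensor amounts to pulling the form back, so a.(e (x) e - u) evaluates as a (x) e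
    minus a.u. *)
Lemma unit_minus_lact u a (phi : bounded_form A) :
  tensor_eval (sval phi) (tensor_lact mul a (ften_rep (unit_minus u))) =
  sval phi (unit_emb a) e - ften_eval u (pull (left_operator Amul a) (sval phi)).
Proof.
have -> : sval phi (unit_emb a) e = sval (pull_form (left_operator Amul a) phi) e e.
  by rewrite /= /pull /= unit_mule.
rewrite -(unit_minus_eval u (pull_form _ phi)); apply: cvg_lim => //.
apply: (@finite_series_cvg K K _ _ _ (fun p => sval phi (unit_emb a ** p.1) p.2)).
exact: form0r.
Qed.

Lemma unit_minus_ract u a (phi : bounded_form A) :
  tensor_eval (sval phi) (tensor_ract mul (ften_rep (unit_minus u)) a) =
  sval phi e (unit_emb a) - ften_eval u (pull (right_operator Amul a) (sval phi)).
Proof.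
have -> : sval phi e (unit_emb a) = sval (pull_form (right_operator Amul a) phi) e e.
  by rewrite /= /pull /= unit_emul.
rewrite -(unit_minus_eval u (pull_form _ phi)); apply: cvg_lim => //.
apply: (@finite_series_cvg K K _ _ _ (fun p => sval phi p.1 (p.2 ** unit_emb a))).
exact: form0l.
Qed.

Lemma semi_contractible_approx_diagonal :
  approx_semi_contractible mul ->
  exists (I : Type) (le : I -> I -> Prop), directed le /\
    exists xi eta : I -> tensor_rep A,
      [/\ (forall i, abs_summable (xi i)),
          (forall i, abs_summable (eta i)),
          (forall a : A, tensor_net_diff_to0 le
             (fun i => tensor_lact mul a (xi i))
             (fun i => tensor_ract mul (eta i) a)),
          pi_net_to_e mul le xi &
          pi_net_to_e mul le eta].
Proof.
move=> /(_ X _ _ (kernel_bimodule Amul Kc Klub) D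
  (diagonal_derivationP Amul Kc Klub)
  (@diagonal_derivation_continuous K A mul Amul Kc Klub)).
move=> [I [le [[inhI leI leT leD] [xi [eta xieta]]]]].
have app_ex (xd : X * {d : K | 0 < d}) : exists u,
    unit_norm (ften_pi mul u) <= sval xd.2 /\
    forall (phi : bounded_form A) M, form_bound (sval phi) M ->
      `|(fs_fun xd.1 phi : K) - ften_eval u (sval phi)| <= sval xd.2 * M.
  by case: xd => x [d d0]; exact: (fs_funP x _ d0).
have [app appP] := choice app_ex.
pose J := (I * {d : K | 0 < d})%type.
(* The second coordinate is the accuracy of the finite approximant; later indices have smaller
   tolerances. *)
pose leJ (i j : J) := le i.1 j.1 /\ sval j.2 <= sval i.2.
have dirJ : directed leJ.
  split.
  - by case: inhI => i; constructor; exact: (i, exist _ 1 ltr01).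
  - by move=> i; split.
  - by move=> i j k [ij1 ij2] [jk1 jk2]; split; [exact: leT jk1|exact: le_trans ij2].
  - move=> [i [d d0]] [j [d' d'0]]; have [k [ik jk]] := leD i j.
    (* The order of K is partial, but positive elements are real and hence comparable. *)
    have [dd'|/ltW d'd] := real_leP (gtr0_real d0) (gtr0_real d'0).
      by exists (k, exist _ d d0).
    by exists (k, exist _ d' d'0).
exists J, leJ; split => //.
pose rep (z : I -> X) (j : J) := ften_rep (unit_minus (app (z j.1, j.2))).
have rep_pi z : pi_net_to_e mul leJ (rep z).
  move=> d d0; case: inhI => i; exists (i, exist _ d d0) => j [_ /= jd].
  rewrite ften_rep_pi unit_minus_pi -[unit_sub _ _]/(e - _ - e).
  rewrite addrAC subrr sub0r unit_normN.
  by apply: le_trans jd; exact: (appP (z j.1, j.2)).1.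
exists (rep xi), (rep eta); split => //; try by move=> j; exact: ften_rep_summable.
move=> a d d0.
have a0 : 0 < 2 * (`|a| + 1) by rewrite mulr_gt0 // norm_plus1_gt0.
have d20 : 0 < d / 2 by rewrite divr_gt0.
(* The pulled-back forms have bound |a| + 1, so this tolerance keeps each of the two approximation
   errors below d / 4 and leaves d / 2 for the net of the semi-inner approximation. *)
have da0 : 0 < d / 2 / (2 * (`|a| + 1)) by rewrite divr_gt0.
have [i0 i0P] := xieta a _ d20.
exists (i0, exist (fun d => 0 < d) _ da0) => j [/= /i0P ij jd] phi phi1.
pose Phi : bounded_form A := exist _ phi (ex_intro _ _ (ball_form_bound phi1)).
rewrite -[phi]/(sval Phi) unit_minus_lact unit_minus_ract.
set u := app _; set v := app _.
have [_ /(_ (pull_form (left_operator Amul a) Phi) _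
  (pull_bound _ (ball_form_bound phi1)))] := appP (xi j.1, j.2).
have [_ /(_ (pull_form (right_operator Amul a) Phi) _
  (pull_bound _ (ball_form_bound phi1)))] := appP (eta j.1, j.2).
rewrite -/u -/v /= !mul1r.
set x := fs_fun (xi j.1) _; set y := fs_fun (eta j.1) _.
set s := ften_eval v _; set t := ften_eval u _ => ys xt.
(* The norm of a.xi - eta.a - D(a) in X bounds its value at [Phi], a form with bound 1. *)
have xy : `|x - y - (phi (unit_emb a) e - phi e (unit_emb a))| <= d / 2.
  apply: le_trans ij; rewrite -[leRHS]mulr1.
  exact: (@fs_fun_le K (tensor_kernel Amul Kc Klub)
    (kernel_lact a (xi j.1) - kernel_ract (eta j.1) a - D a) Phi 1
    (ball_form_bound phi1)).
have dj : sval j.2 * (`|a| + 1) <= d / 2 / 2.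
  by rewrite ler_pdivlMr // -mulrA (mulrC _ 2) -ler_pdivlMr.
have -> : phi (unit_emb a) e - t - (phi e (unit_emb a) - s) =
    (x - t) - (y - s) - (x - y - (phi (unit_emb a) e - phi e (unit_emb a))).
  by ring.
rewrite [leRHS]splitr (le_trans (ler_normB _ _)) // lerD //.
rewrite [leRHS]splitr (le_trans (ler_normB _ _)) // lerD //.
  exact: le_trans dj.
exact: le_trans dj.
Qed.


End NecessityNets.

Theorem theorem2p6 (R : realType) (A : completeNormedModType R[i])
  (mul : A -> A -> A) :
  banach_algebra mul ->
  (approx_semi_contractible mul <->
   exists (I : Type) (le : I -> I -> Prop), directed le /\
     exists xi eta : I -> tensor_rep A,
       [/\ (forall i, abs_summable (xi i)),
           (forall i, abs_summable (eta i)),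
           (forall a : A,
              tensor_net_diff_to0 le
                (fun i => tensor_lact mul a (xi i))
                (fun i => tensor_ract mul (eta i) a)),
           pi_net_to_e mul le xi &
           pi_net_to_e mul le eta]).
Proof.
move=> Amul; have Kc := @complex_complete R; split.
  exact: semi_contractible_approx_diagonal Amul Kc (@complex_nonneg_lub R).
move=> [I [le [dir [xi [eta [sxi seta diff _ pie]]]]]] X l r Xmod D Dder Dcont.
have Xnorming := @norming_functional R X.
exact: (@approx_diagonal_semi_inner _ _ _ Amul Kc X l r Xmod Xnorming D Dder
  Dcont _ _ _ _ dir sxi seta diff pie).
Qed.
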